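(* Let $\tau>0$, $\mu>0$, $c,r,d\in\mathbb{R}$, $T>0$, $a,b>0$, and consider the neutral partial differential equation $$\partial_tu(x,t)=\mu^2\partial_{xx}u(x,t)+\mu^2c^2\partial_{xx}u(x,t-\tau)+r\,u(x,t)+d\,u(x,t-\tau)$$ on the spatial interval $(-a,b)$ with prescribed history function on $[-a,b]\times[-\tau,0]$ and homogeneous Dirichlet boundary conditions at $x=-a$ and $x=b$. Consider the Dirichlet-Neumann waveform relaxation (DNWR) error iteration with relaxation parameter $\theta$ for this problem on the two subdomains $\Omega_1=(-a,0)$ and $\Omega_2=(0,b)$, started from an admissible initial interface error $h^0$. Suppose the subdomains are of equal size, i.e. $a=b$. Then: (i) for $0<\theta<1$, $\theta\neq 1/2$, the DNWR iteration converges linearly; (ii) for $\theta=1/2$, the DNWR iteration converges in two iterations, for every time window length $T>0$.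
   Context: DNWR error iteration. Since the problem is linear, the iteration is written for the error, i.e. with zero history and zero boundary data. Given $h^0:[0,T]\to\mathbb{R}$ (initial error on the interface $\{x=0\}$), for $k=1,2,\dots$ let $e_1^k$ solve the Dirichlet problem $$\partial_te_1^k-\mu^2\partial_{xx}e_1^k-\mu^2c^2\partial_{xx}e_1^k(x,t-\tau)-r e_1^k(x,t)-d e_1^k(x,t-\tau)=0\text{ in }\Omega_1\times(0,T),$$ $$e_1^k=0\text{ on }\Omega_1\times[-\tau,0],\quad e_1^k(-a,t)=0,\quad e_1^k(0,t)=h^{k-1}(t),\ t\in(0,T);$$ then let $e_2^k$ solve the Neumann problem $$\partial_te_2^k-\mu^2\partial_{xx}e_2^k-\mu^2c^2\partial_{xx}e_2^k(x,t-\tau)-r e_2^k(x,t)-d e_2^k(x,t-\tau)=0\text{ in }\Omega_2\times(0,T),$$ $$e_2^k=0\text{ on }\Omega_2\times[-\tau,0],\quad \partial_xe_2^k(0,t)=\partial_xe_1^k(0,t),\quad e_2^k(b,t)=0,\ t\in(0,T);$$ and update $h^k(t)=\theta e_2^k(0,t)+(1-\theta)h^{k-1}(t)$. Regularity conventions. Solutions are classical: continuous on $\overline{\Omega_i}\times[-\tau,T]$, with $\partial_x e_i^k$ continuous on $\overline{\Omega_i}\times[0,T]$, and $\partial_t e_i^k,\partial_{xx}e_i^k$ continuous on $\Omega_i\times(0,T)$. An initial interface error $h^0$ is admissible if it is continuous on $[0,T]$ and all iterates $e_i^k$ exist as such classical solutions. Convergence. Let $\|h\|=\sup_{t\in[0,T]}|h(t)|$.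 The iteration converges linearly if, for every admissible $h^0\not\equiv0$, there is $\rho\in(0,1)$ with $h^{k}\not\equiv 0$ for all $k$ and $\lim_{k\to\infty}\|h^{k}\|/\|h^{k-1}\|=\rho$ (so in particular $h^k\to0$). It converges in two iterations if, for every admissible $h^0$, the errors $e_1^k$, $e_2^k$ and $h^k$ vanish identically for all $k\ge2$. *)

(* Defs.v *)
From mathcomp Require Import all_boot all_order all_algebra.
From mathcomp Require Import all_classical all_reals all_analysis.

Set Implicit Arguments.
Unset Strict Implicit.
Unset Printing Implicit Defensive.

Import Order.TTheory GRing.Theory Num.Theory.
Import numFieldNormedType.Exports.

Local Open Scope classical_set_scope.
Local Open Scope ring_scope.

(* Space-time functions are curried, [u x t], and total on R x R; only their
   values on the closed cylinder [lo, hi] x [-tau, T] are meaningful. *)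

Definition dquot_x (R : realType) (u : R -> R -> R) (x t y : R) : R :=
  (u y t - u x t) / (y - x).

(* The limit is taken inside [lo, hi], so this is the one-sided derivative at
   the endpoints and the usual one in the interior. *)
Definition dx_on (R : realType) (lo hi : R) (u : R -> R -> R) (x t : R) : R :=
  lim (dquot_x u x t @ within `[lo, hi] (dnbhs x)).

Definition dt (R : realType) (u : R -> R -> R) (x t : R) : R :=
  derive1 (u x) t.

Definition dxx (R : realType) (u : R -> R -> R) (x t : R) : R :=
  derive1 (derive1 (u ^~ t)) x.

Record classical_regularity (R : realType) (tau T lo hi : R)
    (u : R -> R -> R) : Prop := ClassicalRegularity {
  regularity_continuous :
    {within `[lo, hi] `*` `[- tau, T], continuous (fun p : R * R => u p.1 p.2)};
  regularity_dx_exists : forall x t : R, x \in `[lo, hi] -> t \in `[0, T] ->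
    cvg (dquot_x u x t @ within `[lo, hi] (dnbhs x));
  regularity_dx_continuous :
    {within `[lo, hi] `*` `[0, T],
      continuous (fun p : R * R => dx_on lo hi u p.1 p.2)};
  regularity_dt_exists : forall x t : R, x \in `]lo, hi[ -> t \in `]0, T[ ->
    derivable (u x) t 1;
  regularity_dt_continuous :
    {within `]lo, hi[ `*` `]0, T[, continuous (fun p : R * R => dt u p.1 p.2)};
  regularity_dxx_exists : forall x t : R, x \in `]lo, hi[ -> t \in `]0, T[ ->
    derivable (derive1 (u ^~ t)) x 1;
  regularity_dxx_continuous :
    {within `]lo, hi[ `*` `]0, T[, continuous (fun p : R * R => dxx u p.1 p.2)}
}.

Definition npde (R : realType) (tau mu c r d T lo hi : R)
    (u : R -> R -> R) : Prop :=
  forall x t : R, x \in `]lo, hi[ -> t \in `]0, T[ ->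
    dt u x t = mu ^+ 2 * dxx u x t + mu ^+ 2 * c ^+ 2 * dxx u x (t - tau)
               + r * u x t + d * u x (t - tau).

Definition zero_history (R : realType) (tau lo hi : R)
    (u : R -> R -> R) : Prop :=
  forall x t : R, x \in `]lo, hi[ -> t \in `[- tau, 0] -> u x t = 0.

Definition dirichlet_solution (R : realType) (tau mu c r d T a : R)
    (h : R -> R) (e1 : R -> R -> R) : Prop :=
  [/\ classical_regularity tau T (- a) 0 e1,
      npde tau mu c r d T (- a) 0 e1,
      zero_history tau (- a) 0 e1,
      forall t : R, t \in `]0, T[ -> e1 (- a) t = 0
    & forall t : R, t \in `]0, T[ -> e1 0 t = h t].

Definition neumann_solution (R : realType) (tau mu c r d T b : R)
    (flux : R -> R) (e2 : R -> R -> R) : Prop :=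
  [/\ classical_regularity tau T 0 b e2,
      npde tau mu c r d T 0 b e2,
      zero_history tau 0 b e2,
      forall t : R, t \in `]0, T[ -> dx_on 0 b e2 0 t = flux t
    & forall t : R, t \in `]0, T[ -> e2 b t = 0].

(* [h k] is h^k for k >= 0, [e1 k] and [e2 k] are e_1^k and e_2^k for k >= 1;
   [e1 0] and [e2 0] are unconstrained and unused. *)
Definition dnwr_errors (R : realType) (tau mu c r d T a b theta : R)
    (h0 : R -> R) (h : nat -> R -> R) (e1 e2 : nat -> R -> R -> R) : Prop :=
  (forall t : R, t \in `[0, T] -> h 0%N t = h0 t) /\
  forall k : nat,
    [/\ dirichlet_solution tau mu c r d T a (h k) (e1 k.+1),
        neumann_solution tau mu c r d T b (dx_on (- a) 0 (e1 k.+1) 0)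
          (e2 k.+1)
      & forall t : R, t \in `[0, T] ->
          h k.+1 t = theta * e2 k.+1 0 t + (1 - theta) * h k t].

Definition admissible (R : realType) (tau mu c r d T a b theta : R)
    (h0 : R -> R) : Prop :=
  {within `[0, T], continuous h0} /\
  exists (h : nat -> R -> R) (e1 e2 : nat -> R -> R -> R),
    dnwr_errors tau mu c r d T a b theta h0 h e1 e2.

Definition vanishes (R : realType) (T : R) (h : R -> R) : Prop :=
  forall t : R, t \in `[0, T] -> h t = 0.

Definition error_vanishes (R : realType) (tau T lo hi : R)
    (u : R -> R -> R) : Prop :=
  forall x t : R, x \in `[lo, hi] -> t \in `[- tau, T] -> u x t = 0.

Definition supnorm (R : realType) (T : R) (h : R -> R) : R :=
  sup [set `|h t| | t in `[0, T]].

Definition converges_linearly (R : realType)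
    (tau mu c r d T a b theta : R) : Prop :=
  forall h0 : R -> R,
    admissible tau mu c r d T a b theta h0 -> ~ vanishes T h0 ->
    exists rho : R, 0 < rho < 1 /\
      forall (h : nat -> R -> R) (e1 e2 : nat -> R -> R -> R),
        dnwr_errors tau mu c r d T a b theta h0 h e1 e2 ->
        (forall k : nat, ~ vanishes T (h k)) /\
        (fun k : nat => supnorm T (h k.+1) / supnorm T (h k)) @ \oo --> rho.

Definition converges_in_two_iterations (R : realType)
    (tau mu c r d T a b theta : R) : Prop :=
  forall h0 : R -> R, admissible tau mu c r d T a b theta h0 ->
    forall (h : nat -> R -> R) (e1 e2 : nat -> R -> R -> R),
      dnwr_errors tau mu c r d T a b theta h0 h e1 e2 ->
      forall k : nat, (2 <= k)%N ->
        [/\ error_vanishes tau T (- a) 0 (e1 k),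
            error_vanishes tau T 0 b (e2 k)
          & vanishes T (h k)].

(* Main.v *)
(* For equal subdomains the even reflection v(x, t) = e2(x, t) + e1(-x, t)
   solves the homogeneous equation on (0, a) with zero history, v_x = 0 at
   x = 0 and v = 0 at x = a, so v vanishes by uniqueness. Hence
   e2(0, t) = - h(t), and one iteration multiplies h by 1 - 2 theta.
   Uniqueness goes step by step in time: on an interval of length tau the
   delayed terms are known to vanish, and the remaining heat equation is
   covered by the maximum principle. *)
Require Import Defs.
From mathcomp Require Import all_boot all_order all_algebra.
From mathcomp Require Import all_classical all_reals all_analysis.
From mathcomp Require Import ring lra.
Import Order.TTheory GRing.Theory Num.Theory.
Import numFieldNormedType.Exports.
Local Open Scope classical_set_scope.
Local Open Scope ring_scope.

(** * Difference quotients and derivative tests at a maximum *)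

(** Caratheodory's criterion: the slope function, given the value [l] at [x], is continuous there
    exactly when the quotient tends to [l]. This links the quotients behind [dx_on] to the calculus
    of [is_derive]. *)
Lemma is_derive_dquotP {R : realType} (f : R -> R) (x l : R) :
  is_derive x 1 f l <-> (f y - f x) / (y - x) @[y --> x^'] --> l.
Proof.
split=> [/is_derive1_caratheodory [g [fE /continuous_withinNx cg <-]]|fl].
  apply: cvg_trans cg; apply: near_eq_cvg; near=> y.
  rewrite fE mulfK// subr_eq0; near: y; exact: nbhs_dnbhs_neq.
apply/is_derive1_caratheodory.
exists (fun z => if z == x then l else (f z - f x) / (z - x)); split.
- move=> z; case: eqVneq => [->|zx]; first by rewrite !subrr mulr0.
  by rewrite divfK// subr_eq0.
- apply/continuous_withinNx; rewrite eqxx; apply: cvg_trans fl.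
  apply: near_eq_cvg; near=> y; rewrite ifN//; near: y.
  exact: nbhs_dnbhs_neq.
- by rewrite eqxx.
Unshelve. all: by end_near. Qed.

Lemma cvg_within_itv_at_right {R : realType} (g : R -> R) (a b l : R) : a < b ->
  g y @[y --> within `[a, b] a^'] --> l -> g y @[y --> a^'+] --> l.
Proof.
move=> ab gl A /gl H.
have {}H : \forall y \near a, y != a -> y \in `[a, b] -> A (g y) := H.
change (\forall y \near a^'+, A (g y)); near=> y.
have ay : a < y by near: y; exact: nbhs_right_gt.
have yb : y < b by near: y; exact: nbhs_right_lt.
have : y != a -> y \in `[a, b] -> A (g y) by near: y; exact: cvg_within H.
by apply; [rewrite gt_eqF|rewrite in_itv /= !ltW].
Unshelve. all: by end_near. Qed.

(** An interior point has a neighbourhood inside [[a, b]], so there the limit defining [dx_on] is an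
    ordinary two-sided derivative. *)
Lemma cvg_within_itvoo {R : realType} (g : R -> R) (a b x l : R) :
  x \in `]a, b[ ->
  g y @[y --> within `[a, b] x^'] --> l -> g y @[y --> x^'] --> l.
Proof.
move=> xab gl A /gl H.
have {}H : \forall y \near x^', y \in `[a, b] -> A (g y) := H.
change (\forall y \near x^', A (g y)); near=> y.
have : y \in `[a, b] -> A (g y) by near: y.
apply; apply: subset_itv_oo_cc.
by near: y; apply/nbhs_dnbhs/near_in_itvoo.
Unshelve. all: by end_near. Qed.

(** Left of [x] the quotient is a nonpositive number over a negative one. The comparison is
    one-sided because a maximum over a time interval may sit at its final time. *)
Lemma is_derive_left_max {R : realType} (f : R -> R) (x l : R) :
  is_derive x 1 f l -> (\forall y \near x^'-, f y <= f x) -> 0 <= l.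
Proof.
move=> /is_derive_dquotP/cvg_dnbhs_at_left fl fx.
apply: (cvgr_to_ge fl); near=> y; apply: mulr_le0.
  by rewrite subr_le0; near: y.
by rewrite invr_le0 subr_le0 ltW//; near: y; exact: nbhs_left_lt.
Unshelve. all: by end_near. Qed.

Lemma is_derive_right_max {R : realType} (f : R -> R) (x l : R) :
  is_derive x 1 f l -> (\forall y \near x^'+, f y <= f x) -> l <= 0.
Proof.
move=> /is_derive_dquotP/cvg_dnbhs_at_right fl fx.
apply: (cvgr_to_le fl); near=> y; apply: mulr_le0_ge0.
  by rewrite subr_le0; near: y.
by rewrite invr_ge0 subr_ge0 ltW//; near: y; exact: nbhs_right_gt.
Unshelve. all: by end_near. Qed.

(** At the maximum [g x = 0]. If [l > 0], then [g > 0] just to the right of [x], and the mean value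
    theorem pushes [f] above [f x]. *)
Lemma second_derive_max {R : realType} (f g : R -> R) (x l : R) :
  (\forall y \near x, is_derive (y : R) 1 f (g y)) -> is_derive x 1 g l ->
  (\forall y \near x, f y <= f x) -> l <= 0.
Proof.
move=> df dg fx; rewrite leNgt; apply/negP => l0.
have gx0 : g x = 0.
  apply/eqP; rewrite eq_le; apply/andP; split.
    apply: (is_derive_right_max _ _ _ (nbhs_singleton df)).
    exact: cvg_within fx.
  apply: (is_derive_left_max _ _ _ (nbhs_singleton df)).
  exact: cvg_within fx.
have gpos : \forall y \near x^'+, 0 < g y.
  move/is_derive_dquotP/cvg_dnbhs_at_right: dg => /cvgr_gt /(_ _ l0) dg.
  near=> y.
  have xy : 0 < y - x by rewrite subr_gt0; near: y; exact: nbhs_right_gt.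
  rewrite -(pmulr_lgt0 _ (x := (y - x)^-1)) ?invr_gt0// -[g y]subr0 -[in X in _ - X]gx0.
  by near: y.
have [e /= e0 He] : \forall y \near x, [/\ is_derive (y : R) 1 f (g y), f y <= f x
    & (x < y -> 0 < g y)].
  near=> y; split; first by near: y.
    by near: y.
  by near: y; move: gpos; rewrite /at_right near_withinE.
have Hin y : x <= y <= x + e / 2 -> [/\ is_derive (y : R) 1 f (g y), f y <= f x
    & (x < y -> 0 < g y)].
  by move=> /andP[h1 h2]; apply: He; rewrite /ball_ /= ltr_norml; apply/andP; split; lra.
have xe : x < x + e / 2 by lra.
have [y|z|c] := @MVT R f g x (x + e / 2) xe.
- by rewrite in_itv /= => /andP[h1 h2]; case: (Hin y) => //; rewrite !ltW.
- apply: (@derivable_within_continuous R) => {}z; rewrite in_itv/= => hz.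
  by have [[]] := Hin z hz.
- rewrite in_itv/= => /andP[xc cxe] fE.
  have [|_ _ /(_ xc) gc] := Hin c; first by rewrite !ltW.
  have [|_ fle _] := Hin (x + e / 2); first by rewrite lexx ltW.
  have : 0 < g c * (x + e / 2 - x) by rewrite mulr_gt0// subr_gt0.
  by rewrite -fE; lra.
Unshelve. all: by end_near. Qed.

(** * Closure by continuity, and slices of functions of two variables *)

(** One-sided limits carry zeros to the endpoints. This is needed because the history is prescribed
    on an open interval in space and the boundary data on an open interval in time. *)
Lemma within_continuous_itv_eq0 {R : realType} (g : R -> R) (a b : R) : a < b ->
  {within `[a, b], continuous g} -> (forall x : R, x \in `]a, b[ -> g x = 0) ->
  forall x : R, x \in `[a, b] -> g x = 0.
Proof.
move=> ab /continuous_within_itvP-/(_ ab)[_ ga gb] g0 x.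
(* An arbitrary proper filter serves both the right limit at [a] and the left limit at [b]. *)
have lim0 (F : set_system R) (l : R) : ProperFilter F ->
    (\forall y \near F, y \in `]a, b[) -> g y @[y --> F] --> l -> l = 0.
  move=> FF yab gl; apply/eqP; rewrite eq_le; apply/andP; split.
    by apply: (cvgr_to_le gl); near=> y; rewrite g0//; near: y.
  by apply: (cvgr_to_ge gl); near=> y; rewrite g0//; near: y.
rewrite in_itv /= !le_eqVlt => /andP[/predU1P[<- _|ax /predU1P[->|xb]]].
- apply: lim0 ga; near=> y; rewrite in_itv /=; apply/andP; split; near: y.
    exact: nbhs_right_gt.
  exact: nbhs_right_lt.
- apply: lim0 gb; near=> y; rewrite in_itv /=; apply/andP; split; near: y.
    exact: nbhs_left_gt.
  exact: nbhs_left_lt.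
- by apply: g0; rewrite in_itv /= ax.
Unshelve. all: by end_near. Qed.

Lemma within_continuous_curry_l {R : realType} (u : R -> R -> R) (A B : set R)
    (t : R) : B t ->
  {within A `*` B, continuous (fun p : R * R => u p.1 p.2)} ->
  {within A, continuous (u ^~ t)}.
Proof.
move=> Bt /subspace_continuousP uc; apply/subspace_continuousP => x Ax W.
move=> /(uc (x, t) (conj Ax Bt)) H.
have {}H : \forall q \near ((x, t) : R * R), (A `*` B) q -> W (u q.1 q.2) := H.
have /(_ _ H) {}H : (y, t) @[y --> x] --> ((x, t) : R * R).
  by apply: (@cvg_pair _ _ _ _ (nbhs x) (nbhs t)); [exact: cvg_id|exact: cvg_cst].
change (\forall y \near x, A y -> W (u y t)).
near=> y => Ay; have : (A `*` B) (y, t) -> W (u y t) by near: y.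
by apply.
Unshelve. all: by end_near. Qed.

Lemma within_continuous_curry_r {R : realType} (u : R -> R -> R) (A B : set R)
    (x : R) : A x ->
  {within A `*` B, continuous (fun p : R * R => u p.1 p.2)} ->
  {within B, continuous (u x)}.
Proof.
move=> Ax /subspace_continuousP uc; apply/subspace_continuousP => t Bt W.
move=> /(uc (x, t) (conj Ax Bt)) H.
have {}H : \forall q \near ((x, t) : R * R), (A `*` B) q -> W (u q.1 q.2) := H.
have /(_ _ H) {}H : (x, s) @[s --> t] --> ((x, t) : R * R).
  by apply: (@cvg_pair _ _ _ _ (nbhs x) (nbhs t)); [exact: cvg_cst|exact: cvg_id].
change (\forall s \near t, B s -> W (u x s)).
near=> s => Bs; have : (A `*` B) (x, s) -> W (u x s) by near: s.
by apply.
Unshelve. all: by end_near. Qed.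

(** * Uniqueness for the heat equation with a zeroth-order term *)

(* Weak maximum principle. The factor [expR (- (r + 1) * t)] makes the
   zeroth-order coefficient negative; the affine barrier [eps * (hi + 1 - x)]
   leaves second derivatives unchanged and makes the slope at [lo] strictly
   positive, which rules out a maximum on the Neumann side. *)
Lemma heat_nonpos {R : realType} (m r lo hi T : R) (u ut ux uxx : R -> R -> R) :
  0 <= m -> lo < hi ->
  {within `[lo, hi] `*` `[0, T], continuous (fun p : R * R => u p.1 p.2)} ->
  (forall x t : R, x \in `]lo, hi[ -> t \in `]0, T[ ->
    [/\ is_derive t 1 (u x) (ut x t), is_derive x 1 (u ^~ t) (ux x t),
        is_derive x 1 (ux ^~ t) (uxx x t)
      & ut x t = m * uxx x t + r * u x t]) ->
  (forall x : R, x \in `]lo, hi[ -> u x 0 = 0) ->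
  (forall t : R, t \in `]0, T[ -> u lo t = 0 \/
    dquot_x u lo t y @[y --> within `[lo, hi] lo^'] --> (0 : R)) ->
  (forall t : R, t \in `]0, T[ -> u hi t = 0) ->
  forall x t : R, x \in `]lo, hi[ -> t \in `]0, T[ -> u x t <= 0.
Proof.
move=> m0 lohi uc du init bl bh x1 t1 hx1 ht1; rewrite leNgt; apply/negP => u1.
have T0 : 0 < T by move: ht1; rewrite in_itv /=; lra.
(* The corners are included, since the maximum point found below could be one of them. *)
have init' x : x \in `[lo, hi] -> u x 0 = 0.
  apply: within_continuous_itv_eq0 lohi _ init x.
  by apply: within_continuous_curry_l uc; rewrite /= in_itv /= lexx ltW.
move: hx1 ht1; rewrite !in_itv /= => /andP[lox1 x1hi] /andP[t10 t1T].
pose lam := r + 1.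
pose E t := expR (- (lam * t)).
(* This [eps] makes the barrier at [x1] half of [E t1 * u x1 t1], so [w x1 t1] stays positive. *)
pose eps := E t1 * u x1 t1 / 2 / (hi + 1 - x1).
have E0 t : 0 < E t by exact: expR_gt0.
have eps0 : 0 < eps by rewrite /eps !divr_gt0 ?mulr_gt0//; lra.
pose w x t := E t * u x t - eps * (hi + 1 - x).
have w1 : 0 < w x1 t1.
  rewrite /w /eps divfK; last by rewrite gt_eqF//; lra.
  by have := mulr_gt0 (E0 t1) u1; lra.
(* The cylinder stops at [t1 < T], so a maximum at its final time still lies where the equation
   holds. *)
pose A : set (R * R) := `[lo, hi] `*` `[0, t1].
have [] := @compact_EVT_max _ R (fun p => w p.1 p.2) A.
- exists (lo, 0); split => /=; rewrite in_itv /= lexx; lra.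
- by apply: compact_setX; exact: segment_compact.
- have /subspace_continuousP {}uc : {within A, continuous (fun p : R * R => u p.1 p.2)}.
    apply: continuous_subspaceW uc => -[x t] [/= hx]; split => //=.
    by move: b; rewrite !in_itv /=; lra.
  apply/subspace_continuousP => p Ap; apply: cvgB.
    apply: cvgM; last exact: uc.
    apply: cvg_within_filter; rewrite /E.
    apply: (@continuous_cvg _ _ _ _ _ (fun q => - (lam * q.2)) expR).
      exact: continuous_expR.
    by apply: cvgN; apply: cvgMr; exact: cvg_snd.
  apply: cvg_within_filter; apply: cvgMr; apply: cvgB; first exact: cvg_cst.
  exact: cvg_fst.
move=> [x0 t0]; rewrite inE => -[/= hx0 ht0] wmax.
have {}wmax x t : x \in `[lo, hi] -> t \in `[0, t1] -> w x t <= w x0 t0.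
  by move=> hx ht; apply: (wmax (x, t)); rewrite inE; split.
have {}hx0 : x0 \in `[lo, hi] := hx0; have {}ht0 : t0 \in `[0, t1] := ht0.
have w0 : 0 < w x0 t0.
  by apply: lt_le_trans w1 (wmax _ _ _ _); rewrite in_itv /= ?lexx ?ltW.
(* The barrier is nonnegative, so [w > 0] gives [u > 0]; this excludes the initial time and the side
   [hi]. *)
have u0 : 0 < u x0 t0.
  rewrite -(pmulr_rgt0 _ (E0 t0)); move: w0; rewrite /w subr_gt0.
  apply: le_lt_trans; apply: mulr_ge0; first exact: ltW.
  by move: hx0; rewrite in_itv /= => /andP[_ hx0]; lra.
have t00 : t0 != 0 by apply: contraTneq u0 => ->; rewrite init'// ltxx.
move: (ht0); rewrite in_itv /= le_eqVlt eq_sym (negPf t00) /= => /andP[t0_gt0 t0t1].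
have t0T : t0 \in `]0, T[ by rewrite in_itv /= t0_gt0 (le_lt_trans t0t1).
have x0hi : x0 != hi by apply: contraTneq u0 => ->; rewrite bh// ltxx.
have [x0lo|x0lo] := eqVneq x0 lo.
  subst x0; have [ul0|] := bl _ t0T; first by rewrite ul0 ltxx in u0.
  move=> /(cvg_within_itv_at_right _ _ _ _ lohi) ul.
  (* Maximality of [w] at [lo] bounds every quotient of [u] by [- (eps / E t0)], which is
     incompatible with a zero Neumann slope. *)
  suff : 0 <= - (eps / E t0) by rewrite oppr_ge0 leNgt divr_gt0.
  apply: (cvgr_to_le ul); near=> y.
  have loy : lo < y by near: y; exact: nbhs_right_gt.
  have yhi : y < hi by near: y; exact: nbhs_right_lt.
  rewrite /dquot_x ler_pdivrMr ?subr_gt0// -mulNr mulrAC ler_pdivlMr//.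
  have /wmax : y \in `[lo, hi] by rewrite in_itv /= !ltW.
  by move=> /(_ _ ht0); rewrite /w; lra.
have x0i : x0 \in `]lo, hi[.
  by move: hx0; rewrite !in_itv /= !le_eqVlt (negPf x0hi) eq_sym (negPf x0lo).
have [dt0 _ dxx0 pde] := du _ _ x0i t0T.
have ut_ge0 : 0 <= E t0 * ut x0 t0 - lam * E t0 * u x0 t0.
  have dE : is_derive t0 1 E (E t0 * - lam).
    apply: (@is_derive1_comp _ expR (fun t => - (lam * t))).
    have dl : is_derive t0 1 (- (lam *: @id R)) (- (lam *: 1)) by typeclasses eauto.
    by apply: is_derive_eq dl _; rewrite /GRing.scale /= mulr1.
  apply: (is_derive_left_max (w x0) t0).
    have dw : is_derive t0 1 (E * u x0 - cst (eps * (hi + 1 - x0)))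
      (E t0 *: ut x0 t0 + u x0 t0 *: (E t0 * - lam) - 0) by typeclasses eauto.
    by apply: is_derive_eq dw _; rewrite subr0 /GRing.scale /=; ring.
  near=> t; apply: wmax => //; rewrite in_itv /=; apply/andP; split.
    by apply: ltW; near: t; exact: nbhs_left_gt.
  by apply: le_trans t0t1; near: t; exact: nbhs_left_le.
have uxx_le0 : E t0 * uxx x0 t0 <= 0.
  apply: (second_derive_max (w ^~ t0) (fun x => E t0 * ux x t0 + eps) x0).
  - near=> x; rewrite /w.
    have hx : x \in `]lo, hi[ by near: x; exact: near_in_itvoo.
    have [_ ? _ _] := du _ _ hx t0T.
    have dw : is_derive x 1 (E t0 *: (u ^~ t0) - eps *: (cst (hi + 1) - id))
      (E t0 *: ux x t0 - eps *: (0 - 1)) by typeclasses eauto.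
    by apply: is_derive_eq dw _; rewrite /GRing.scale /=; ring.
  - have dw : is_derive x0 1 (E t0 *: (ux ^~ t0) + cst eps)
      (E t0 *: uxx x0 t0 + 0) by typeclasses eauto.
    by apply: is_derive_eq dw _; rewrite addr0.
  - near=> x; apply: wmax => //; apply: subset_itv_oo_cc.
    by near: x; exact: near_in_itvoo.
(* Inserting the equation into [ut_ge0] leaves [0 <= m * (E t0 * uxx x0 t0) - E t0 * u x0 t0], whose
   right side is negative. *)
have := mulr_gt0 (E0 t0) u0; rewrite pde in ut_ge0.
have := mulr_ge0_le0 m0 uxx_le0; rewrite /lam in ut_ge0; lra.
Unshelve. all: by end_near. Qed.

(** The equation and both kinds of boundary condition are linear and homogeneous, so [heat_nonpos]
    applies to [u] and to [- u]. *)
Lemma heat_eq0 {R : realType} (m r lo hi T : R) (u ut ux uxx : R -> R -> R) :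
  0 <= m -> lo < hi ->
  {within `[lo, hi] `*` `[0, T], continuous (fun p : R * R => u p.1 p.2)} ->
  (forall x t : R, x \in `]lo, hi[ -> t \in `]0, T[ ->
    [/\ is_derive t 1 (u x) (ut x t), is_derive x 1 (u ^~ t) (ux x t),
        is_derive x 1 (ux ^~ t) (uxx x t)
      & ut x t = m * uxx x t + r * u x t]) ->
  (forall x : R, x \in `]lo, hi[ -> u x 0 = 0) ->
  (forall t : R, t \in `]0, T[ -> u lo t = 0 \/
    dquot_x u lo t y @[y --> within `[lo, hi] lo^'] --> (0 : R)) ->
  (forall t : R, t \in `]0, T[ -> u hi t = 0) ->
  forall x t : R, x \in `]lo, hi[ -> t \in `]0, T[ -> u x t = 0.
Proof.
move=> m0 lohi uc du init bl bh x t hx ht.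
apply/eqP; rewrite eq_le; apply/andP; split.
  exact: (heat_nonpos _ _ _ _ _ _ _ _ _ m0 lohi uc du init bl bh).
rewrite -oppr_le0.
apply: (heat_nonpos m r lo hi T (fun x t => - u x t) (fun x t => - ut x t)
  (fun x t => - ux x t) (fun x t => - uxx x t) m0 lohi) hx ht => {x t}.
- move: uc => /subspace_continuousP uc; apply/subspace_continuousP => p Ap.
  by apply: cvgN; exact: uc.
- move=> x t hx ht; have [dut dux duxx pde] := du _ _ hx ht.
  split; [exact: is_deriveN|exact: is_deriveN|exact: is_deriveN|].
  by rewrite pde; ring.
- by move=> x hx; rewrite init// oppr0.
- move=> t ht; have [->|ul] := bl _ ht; [by left; rewrite oppr0|right].
  rewrite -oppr0 (_ : dquot_x _ lo t = (fun y => - dquot_x u lo t y)).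
    exact: cvgN.
  by apply/funext => y; rewrite /dquot_x; ring.
- by move=> t ht; rewrite bh// oppr0.
Qed.

(** * Uniqueness for the neutral equation *)

Lemma is_derive_unique {R : realType} (f : R -> R) (x l l' : R) :
  is_derive x 1 f l -> is_derive x 1 f l' -> l = l'.
Proof. by move=> [_ <-] [_ <-]. Qed.

Lemma is_derive_itv_eq0 {R : realType} (f : R -> R) (a b x : R) :
  (forall y : R, y \in `]a, b[ -> f y = 0) -> x \in `]a, b[ ->
  is_derive x 1 f 0.
Proof.
move=> f0 xab; apply: (near_eq_is_derive _ (is_derive_cst 0 x 1)).
by near=> y; rewrite f0//; near: y; exact: near_in_itvoo.
Unshelve. all: by end_near. Qed.

(* Method of steps: once [u] vanishes up to time [n * tau], the delayed terms
   drop out of the equation up to time [n.+1 * tau]. *)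
Lemma neutral_eq0 {R : realType} (tau m k r d lo hi T : R)
    (u ut ux uxx : R -> R -> R) :
  0 < tau -> 0 <= m -> lo < hi -> 0 < T ->
  {within `[lo, hi] `*` `[- tau, T],
    continuous (fun p : R * R => u p.1 p.2)} ->
  (forall x t : R, x \in `]lo, hi[ -> t \in `]0, T[ ->
    [/\ is_derive t 1 (u x) (ut x t), is_derive x 1 (u ^~ t) (ux x t),
        is_derive x 1 (ux ^~ t) (uxx x t)
      & ut x t = m * uxx x t + k * uxx x (t - tau)
                 + r * u x t + d * u x (t - tau)]) ->
  (forall x t : R, x \in `]lo, hi[ -> t \in `[- tau, 0] ->
    u x t = 0 /\ uxx x t = 0) ->
  (forall t : R, t \in `]0, T[ -> u lo t = 0 \/
    dquot_x u lo t y @[y --> within `[lo, hi] lo^'] --> (0 : R)) ->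
  (forall t : R, t \in `]0, T[ -> u hi t = 0) ->
  forall x t : R, x \in `[lo, hi] -> t \in `[- tau, T] -> u x t = 0.
Proof.
move=> tau0 m0 lohi T0 uc du hist bl bh.
(* The induction carries [uxx] along with [u], because the next step has to cancel the delayed
   diffusion term as well. *)
have steps n (x t : R) : x \in `]lo, hi[ -> - tau <= t < T -> t < n%:R * tau ->
    u x t = 0 /\ uxx x t = 0.
  elim: n x t => [|n IH] x t hx /andP[taut tT] tn.
    by apply: hist => //; rewrite in_itv /=; lra.
  have [t0|t0] := leP t 0; first by apply: hist => //; rewrite in_itv /= taut.
  (* The heat equation is solved again from time 0: for [s < S] the delayed time [s - tau] lies
     below [n%:R * tau], so no restart at a later time is needed. *)
  pose S := Num.min T (n.+1%:R * tau).
  have u0 y : y \in `]lo, hi[ -> u y t = 0.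
    move=> hy; apply: (heat_eq0 m r lo hi S u ut ux uxx) (hy) _ => //.
    - apply: continuous_subspaceW uc => -[z s] [/= hz hs]; split => //=.
      move: hs; rewrite !in_itv /= le_min; lra.
    - move=> z s hz; rewrite in_itv /= lt_min => /and3P[s0 sT sn].
      have hs : s \in `]0, T[ by rewrite in_itv /= s0.
      have [dt0 dx0 dxx0 pde] := du _ _ hz hs; split => //.
      have [|| u0 uxx0] := IH z (s - tau) hz; first by lra.
        by move: sn; rewrite -natr1; lra.
      by rewrite pde u0 uxx0; ring.
    - by move=> z hz; case: (hist z 0 hz) => //; rewrite in_itv /= lexx; lra.
    - move=> s; rewrite in_itv /= lt_min => /and3P[s0 sT _].
      by apply: bl; rewrite in_itv /= s0.
    - move=> s; rewrite in_itv /= lt_min => /and3P[s0 sT _].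
      by apply: bh; rewrite in_itv /= s0.
    - by rewrite in_itv /= t0 lt_min tT.
  split; first exact: u0.
  have ht : t \in `]0, T[ by rewrite in_itv /= t0.
  have ux0 y : y \in `]lo, hi[ -> ux y t = 0.
    move=> hy; have [_ + _ _] := du _ _ hy ht.
    by move/is_derive_unique; apply; exact: is_derive_itv_eq0 u0 hy.
  have [_ _ + _] := du _ _ hx ht.
  by move/is_derive_unique; apply; exact: is_derive_itv_eq0 ux0 hx.
(* Times before [T] are reached in finitely many steps by the Archimedean property, and [T] itself
   by continuity. *)
have inner x t : x \in `]lo, hi[ -> t \in `[- tau, T] -> u x t = 0.
  move=> hx; apply: (within_continuous_itv_eq0 (u x) (- tau) T); first by lra.
    apply: within_continuous_curry_r uc; exact: subset_itv_oo_cc hx.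
  move=> {}t; rewrite in_itv /= => /andP[taut tT].
  have tb := archi_boundP (divr_ge0 (normr_ge0 t) (ltW tau0)).
  have [||//] := steps (Num.bound (`|t| / tau)) x t hx.
    by rewrite (ltW taut).
  by move: tb; rewrite ltr_pdivrMr//; apply: le_lt_trans; exact: ler_norm.
move=> + t + ht; apply: (within_continuous_itv_eq0 (u ^~ t)) => //.
  by apply: within_continuous_curry_l uc.
by move=> x hx; exact: inner.
Qed.

(** * Classical solutions of the two subdomain problems *)

Lemma classical_is_derive {R : realType} (tau T lo hi : R) (u : R -> R -> R) :
  classical_regularity tau T lo hi u ->
  forall x t : R, x \in `]lo, hi[ -> t \in `]0, T[ ->
  [/\ is_derive t 1 (u x) (dt u x t),
      is_derive x 1 (u ^~ t) (derive1 (u ^~ t) x)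
    & is_derive x 1 (derive1 (u ^~ t)) (dxx u x t)].
Proof.
move=> [_ dx _ dt _ dxx _] x t hx ht; split.
- by rewrite /Defs.dt derive1E; apply/derivableP/dt.
- have /(cvg_within_itvoo _ _ _ _ _ hx)/is_derive_dquotP [du _] :=
    dx x t (subset_itv_oo_cc hx) (subset_itv_oo_cc ht).
  by rewrite derive1E; exact/derivableP.
- by rewrite /Defs.dxx derive1E; apply/derivableP/dxx.
Qed.

(** The regularity class gives no derivatives at history times; they are computed from vanishing on
    an open interval. This starts the method of steps. *)
Lemma zero_history_dxx {R : realType} (tau lo hi : R) (u : R -> R -> R) :
  zero_history tau lo hi u ->
  forall x t : R, x \in `]lo, hi[ -> t \in `[- tau, 0] -> dxx u x t = 0.
Proof.
move=> u0 x t hx ht.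
have ux0 y : y \in `]lo, hi[ -> derive1 (u ^~ t) y = 0.
  move=> hy; have [_] := is_derive_itv_eq0 _ _ _ _ (fun z hz => u0 z t hz ht) hy.
  by rewrite derive1E.
by have [_] := is_derive_itv_eq0 _ _ _ _ ux0 hx; rewrite /dxx derive1E.
Qed.

(** Uniqueness for the Dirichlet problem; it serves the case [theta = 1 / 2], where the interface
    data become zero. *)
Lemma dirichlet_eq0 {R : realType} (tau mu c r d T a : R) (h : R -> R)
    (e1 : R -> R -> R) : 0 < tau -> 0 < a -> 0 < T ->
  dirichlet_solution tau mu c r d T a h e1 ->
  (forall t : R, t \in `]0, T[ -> h t = 0) -> error_vanishes tau T (- a) 0 e1.
Proof.
move=> tau0 a0 T0 [reg pde hist bl bh] h0.
apply: (neutral_eq0 tau (mu ^+ 2) (mu ^+ 2 * c ^+ 2) r d _ _ T e1 (dt e1)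
  (fun x t => derive1 (e1 ^~ t) x) (dxx e1) tau0 (sqr_ge0 mu) _ T0).
- by rewrite oppr_lt0.
- exact: regularity_continuous reg.
- move=> x t hx ht; have [? ? ?] := classical_is_derive _ _ _ _ _ reg _ _ hx ht.
  by split => //; exact: pde.
- by move=> x t hx ht; split; [exact: hist|exact: (zero_history_dxx tau (- a) 0)].
- by move=> t ht; left; exact: bl.
- by move=> t ht; rewrite bh// h0.
Qed.

Lemma neumann_reflection {R : realType} (tau mu c r d T a : R) (h : R -> R)
    (e1 e2 : R -> R -> R) : 0 < tau -> 0 < a -> 0 < T ->
  dirichlet_solution tau mu c r d T a h e1 ->
  neumann_solution tau mu c r d T a (dx_on (- a) 0 e1 0) e2 ->
  forall x t : R, x \in `[0, a] -> t \in `[- tau, T] -> e2 x t = - e1 (- x) t.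
Proof.
move=> tau0 a0 T0 [reg1 pde1 hist1 bl1 _] [reg2 pde2 hist2 bl2 bh2] x t hx ht.
apply/eqP; rewrite -addr_eq0; apply/eqP; move: x t hx ht.
have oppcc (x : R) : x \in `[0, a] -> - x \in `[- a, 0].
  by rewrite !in_itv /=; lra.
have oppoo (x : R) : x \in `]0, a[ -> - x \in `]- a, 0[.
  by rewrite !in_itv /=; lra.
apply: (neutral_eq0 tau (mu ^+ 2) (mu ^+ 2 * c ^+ 2) r d 0 a T
  (fun x t => e2 x t + e1 (- x) t) (fun x t => dt e2 x t + dt e1 (- x) t)
  (fun x t => derive1 (e2 ^~ t) x - derive1 (e1 ^~ t) (- x))
  (fun x t => dxx e2 x t + dxx e1 (- x) t) tau0 (sqr_ge0 mu) a0 T0).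
- have /subspace_continuousP c1 := regularity_continuous reg1.
  have /subspace_continuousP c2 := regularity_continuous reg2.
  apply/subspace_continuousP => -[x t] [/= hx ht]; apply: cvgD.
    exact: (c2 (x, t)).
  (* Continuity of the reflected [e1] is pulled back along the map [(x, t)] to [(- x, t)], which
     sends one closed cylinder into the other. *)
  move=> W /(c1 (- x, t) (conj (oppcc _ hx) ht)) H.
  have {}H : \forall q \near ((- x, t) : R * R),
    (`[- a, 0] `*` `[- tau, T]) q -> W (e1 q.1 q.2) := H.
  have /(_ _ H) {}H : (- p.1, p.2) @[p --> ((x, t) : R * R)] --> ((- x, t) : R * R).
    apply: (@cvg_pair _ _ _ _ (nbhs (- x)) (nbhs t)); last exact: cvg_snd.
    by apply: cvgN; exact: cvg_fst.
  change (\forall p \near ((x, t) : R * R),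
    (`[0, a] `*` `[- tau, T]) p -> W (e1 (- p.1) p.2)).
  near=> p => -[/= hp1 hp2].
  have : (`[- a, 0] `*` `[- tau, T]) (- p.1, p.2) -> W (e1 (- p.1) p.2).
    by near: p.
  by apply; split => //=; exact: oppcc.
- move=> x t hx ht; have hx' := oppoo _ hx.
  have [dt1 dx1 dxx1] := classical_is_derive _ _ _ _ _ reg1 _ _ hx' ht.
  have [dt2 dx2 dxx2] := classical_is_derive _ _ _ _ _ reg2 _ _ hx ht.
  (* Each space derivative of the reflected [e1] brings a factor [-1]: first derivatives are
     subtracted, second ones added, and the equation is preserved. *)
  have dopp := is_deriveNid x 1.
  split.
  + exact: is_deriveD.
  + apply: is_deriveD; rewrite -mulrN1.
    exact: (@is_derive1_comp _ (e1 ^~ t) -%R).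
  + have dN : is_derive x 1 (derive1 (e1 ^~ t) \o -%R) (dxx e1 (- x) t * -1).
      exact: is_derive1_comp.
    by have := is_deriveB dxx2 dN; rewrite mulrN1 opprK.
  + rewrite (pde2 _ _ hx ht) (pde1 _ _ hx' ht).
    move: (dxx e1 (- x) t) (dxx e1 (- x) (t - tau)) => A B.
    by move: (dxx e2 x t) (dxx e2 x (t - tau)) => C D; ring.
- move=> x t hx ht; have hx' := oppoo _ hx.
  split; first by rewrite (hist1 _ _ hx' ht) (hist2 _ _ hx ht) addr0.
  rewrite (zero_history_dxx _ _ _ _ hist1 _ _ hx' ht).
  by rewrite (zero_history_dxx _ _ _ _ hist2 _ _ hx ht) addr0.
(* The quotient of the reflected [e1] at [y] is minus that of [e1] at [- y]. Both one-sided slopes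
   at 0 equal the transmitted flux, so they cancel. *)
- move=> t ht; right; rewrite -[X in _ --> X](subrr (dx_on (- a) 0 e1 0 t)).
  have ht' := subset_itv_oo_cc ht.
  have l1 : dquot_x e1 0 t y @[y --> within `[- a, 0] 0^']
      --> dx_on (- a) 0 e1 0 t.
    by apply: (regularity_dx_exists reg1) => //; rewrite in_itv /= lexx; lra.
  have l2 : dquot_x e2 0 t y @[y --> within `[0, a] 0^']
      --> dx_on (- a) 0 e1 0 t.
    rewrite -(bl2 t ht).
    by apply: (regularity_dx_exists reg2) => //; rewrite in_itv /= lexx; lra.
  rewrite (_ : dquot_x _ 0 t = (fun y => dquot_x e2 0 t y - dquot_x e1 0 t (- y))).
    apply: cvgB => // W /l1 H.
    have {}H : \forall y \near (0 : R), y != 0 -> y \in `[- a, 0] ->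
      W (dquot_x e1 0 t y) := H.
    change (\forall y \near (0 : R), y != 0 -> y \in `[0, a] ->
      W (dquot_x e1 0 t (- y))).
    have /(_ _ H) {}H : - y @[y --> (0 : R)] --> (0 : R).
      by rewrite -[X in _ --> X]oppr0; apply: cvgN; exact: cvg_id.
    have {}H : \forall y \near (0 : R), - y != 0 -> - y \in `[- a, 0] ->
      W (dquot_x e1 0 t (- y)) := H.
    apply: filterS H => y H y0 ya; apply: H; first by rewrite oppr_eq0.
    exact: oppcc.
  by apply/funext => y; rewrite /dquot_x oppr0 !addr0 invrN; ring.
- by move=> t ht; rewrite bh2// bl1// addr0.
Unshelve. all: by end_near. Qed.

(** * The interface recursion and the convergence rates *)

(** Reflection at [x = 0] turns the update into [theta * (- h k t) + (1 - theta) * h k t]. *)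
Lemma dnwr_errors_geometric {R : realType} (tau mu c r d T a theta : R)
    (h0 : R -> R) (h : nat -> R -> R) (e1 e2 : nat -> R -> R -> R) :
  0 < tau -> 0 < a -> 0 < T -> {within `[0, T], continuous h0} ->
  dnwr_errors tau mu c r d T a a theta h0 h e1 e2 ->
  forall (k : nat) (t : R), t \in `[0, T] ->
    h k t = (1 - 2 * theta) ^+ k * h0 t.
Proof.
move=> tau0 a0 T0 h0c [hh0 err]; elim=> [|k IH] t ht.
  by rewrite hh0// mul1r.
have [dir neu ->//] := err k; have [reg _ _ _ bh] := dir.
have subT (s : R) : s \in `[0, T] -> s \in `[- tau, T].
  by rewrite !in_itv /=; lra.
rewrite (neumann_reflection _ _ _ _ _ _ _ _ _ _ tau0 a0 T0 dir neu) ?subT//; last first.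
  by rewrite in_itv /= lexx ltW.
suff -> : e1 k.+1 (- 0) t = h k t by rewrite IH// exprS; ring.
(* The Dirichlet condition holds only for [0 < t < T]. The endpoints follow by continuity, that of
   [h k] coming from its formula in terms of [h0]. *)
have /subspace_continuousP e1c : {within `[0, T], continuous (e1 k.+1 0)}.
  apply: (@continuous_subspaceW _ _ _ `[- tau, T]); first exact: subT.
  apply: within_continuous_curry_r (regularity_continuous reg).
  by rewrite /= in_itv /= lexx; lra.
apply/eqP; rewrite oppr0 -subr_eq0 IH//; apply/eqP.
apply: (within_continuous_itv_eq0
  (fun s => e1 k.+1 0 s - (1 - 2 * theta) ^+ k * h0 s) _ _ T0) ht.
  move/subspace_continuousP: h0c => h0c; apply/subspace_continuousP => s hs.
  by apply: cvgB; [exact: e1c|apply: cvgMr; exact: h0c].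
by move=> s hs; rewrite bh// IH ?subrr//; exact: subset_itv_oo_cc.
Qed.

(** All iterates are multiples of [h0], so a single maximising time [s] evaluates every norm. *)
Lemma supnorm_attained {R : realType} (T : R) (h : R -> R) (s : R) :
  s \in `[0, T] -> (forall t : R, t \in `[0, T] -> `|h t| <= `|h s|) ->
  supnorm T h = `|h s|.
Proof.
move=> hs hmax.
have ub : ubound [set `|h t| | t in `[0, T]] `|h s| by move=> _ [t ht <-]; exact: hmax.
apply/eqP; rewrite eq_le; apply/andP; split.
  by apply: ge_sup => //; exists (`|h s|); exists s.
by apply: ub_le_sup; [exists (`|h s|)|exists s].
Qed.

Theorem theorem5 (R : realType) (tau mu c r d a b : R)
    (htau : 0 < tau) (hmu : 0 < mu) (ha : 0 < a) (hb : 0 < b) (hab : a = b) :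
  (forall T theta : R, 0 < T -> 0 < theta < 1 -> theta != 1 / 2 ->
     converges_linearly tau mu c r d T a b theta) /\
  (forall T : R, 0 < T ->
     converges_in_two_iterations tau mu c r d T a b (1 / 2)).
Proof.
subst b; split=> [T theta T0 /andP[th0 th1] th2 h0 [h0c _] h0n0|
  T T0 h0 [h0c _] h e1 e2 err [//|k] k1].
  (* The factor of one iteration: [theta != 1 / 2] makes it nonzero, and [0 < theta < 1] gives
     [|q| < 1]. The ratios of norms are then constantly [|q|]. *)
  pose q := 1 - 2 * theta.
  have q0 : q != 0 by apply: contraNneq th2; rewrite /q => ?; apply/eqP; lra.
  exists (`|q|); split.
    by rewrite normr_gt0 q0 ltr_norml /q; apply/andP; split; lra.
  move=> h e1 e2 err.
  have hE := dnwr_errors_geometric _ _ _ _ _ _ _ _ _ _ _ _ htau ha T0 h0c err.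
  split=> [k hk|].
    apply: h0n0 => t ht; have /eqP := hk t ht.
    by rewrite hE// mulf_eq0 expf_eq0 (negPf q0) andbF => /eqP.
  have [|s hs smax] := @EVT_max R (fun t => `|h0 t|) 0 T (ltW T0).
    move/subspace_continuousP: h0c => h0c; apply/subspace_continuousP => t ht.
    by apply: cvg_norm; exact: h0c.
  have h0s : `|h0 s| != 0.
    apply/eqP => h0s; apply: h0n0 => t /smax.
    by rewrite h0s normr_le0 => /eqP.
  have supE k : supnorm T (h k) = `|q| ^+ k * `|h0 s|.
    rewrite (supnorm_attained _ _ s)// ?hE ?normrM ?normrX// => t ht.
    by rewrite hE// normrM normrX ler_wpM2l ?exprn_ge0// smax.
  rewrite (_ : (fun k => _) = fun=> `|q|); first exact: cvg_cst.
  apply/funext => k; rewrite !supE exprS -mulrA mulfK//.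
  by rewrite mulf_neq0// expf_neq0// normr_eq0.
have hE := dnwr_errors_geometric _ _ _ _ _ _ _ _ _ _ _ _ htau ha T0 h0c err.
have h_eq0 n t : t \in `[0, T] -> h n.+1 t = 0.
  by move=> ht; rewrite hE// exprS [1 - _](_ : _ = 0) ?mul0r//; lra.
(* The index shift explains the count of two: [e1 k.+2] is driven by [h k.+1], which already
   vanishes, whereas [e1 1] is driven by [h 0]. *)
case: k k1 => // k _; have [dir neu _] := err.2 k.+1.
have e10 : error_vanishes tau T (- a) 0 (e1 k.+2).
  apply: dirichlet_eq0 dir _ => // t ht.
  exact/h_eq0/subset_itv_oo_cc.
split => //; last by move=> t; exact: h_eq0.
move=> x t hx ht.
rewrite (neumann_reflection _ _ _ _ _ _ _ _ _ _ htau ha T0 dir neu)// e10 ?oppr0//.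
by move: hx; rewrite !in_itv /=; lra.
Qed.
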